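(* If $\{C,D\}$ is a Kaprekar 2-cycle where $C$ and $D$ have the same smallest digit, then $$\{\overline{C},\overline{D}\}=\{9_{z}8_{z-v-u}7_{z+v}6_{z-v}5_z4_z3_{z-v}2_{z+v}1_{z-v-u},\ 9_{z}8_{z-v-u}7_{z+u}6_{z-u}5_z4_z3_{z-u}2_{z+u}1_{z-v-u}\}$$ for some nonnegative integers $u$, $v$, $z$ such that $z>u+v>0$ and $u\neq v$.
   Context: All integers are written in base 10. Fix a number of digits $n$; integers are written with exactly $n$ decimal digits, padded with leading zeros if necessary. For such an integer $N$, $\overline{N}$ and $\underline{N}$ denote the numbers obtained by writing the $n$ digits of $N$ in descending and ascending order respectively, and $k(N)=\overline{N}-\underline{N}$, again regarded as an $n$-digit number (padded with leading zeros if necessary). A Kaprekar 2-cycle is a pair $\{C,D\}$ of distinct $n$-digit integers (for some $n$) with $k(C)=D$ and $k(D)=C$. Notation: for a digit $\delta$ and an integer $m\ge 0$, $\delta_m$ denotes $m$ consecutive copies of the digit $\delta$; so e.g. $9_26_35_1$ is the number $996665$. *)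

(* Defs.v *)
From mathcomp Require Import all_boot.

Set Implicit Arguments.
Unset Strict Implicit.
Unset Printing Implicit Defensive.

(* Most significant digit first; padded with leading zeros to length n. *)
Definition digits (n N : nat) : seq nat :=
  rev (mkseq (fun i => N %/ 10 ^ i %% 10) n).

Definition of_digits (s : seq nat) : nat :=
  foldl (fun acc d => acc * 10 + d) 0 s.

Definition descending (n N : nat) : nat := of_digits (sort geq (digits n N)).

Definition ascending (n N : nat) : nat := of_digits (sort leq (digits n N)).

(* No truncation occurs here: ascending n N <= descending n N. *)
Definition kaprekar (n N : nat) : nat := descending n N - ascending n N.

(* Padding zeros count as digits. *)
Definition min_digit (n N : nat) : nat := \big[minn/9]_(d <- digits n N) d.

Definition kaprekar_2cycle (n C D : nat) : Prop :=
  [/\ C < 10 ^ n, D < 10 ^ n, C != D, kaprekar n C = D & kaprekar n D = C].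

(* runs [:: (9, 2); (6, 3); (5, 1)] is the number 996665. *)
Definition runs (s : seq (nat * nat)) : nat := of_digits (tally_seq s).

(* Main.v *)
Require Import Defs.
From mathcomp Require Import all_boot.
From mathcomp Require Import zify.

(* If [d_1 >= ... >= d_r > 0] are the nonzero differences between the digits at
   mirror positions of a decreasingly sorted N and x of the digits are left over,
   then the digits of k(N) are
     d_1, ..., d_(r-1), d_r - 1, 9 (x times), 9 - d_r, ..., 9 - d_2, 10 - d_1.
   Let s be the common smallest digit of a 2-cycle.  Counting the digit s in
   C = k(D) and in D = k(C) gives a chain of inequalities going around the cycle.
   If both numbers contain a 9, the chain consists of equalities and forces
   d_r = s + 1 and d_1 = 9 - s: the two corrections (-1 and +1) in the list above
   cancel, so apart from z extra nines both digit multisets are invariant under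
   j |-> 9 - j, with the same z.  Otherwise neither number contains a 9 and
   d_1 = 8 - 2 s.  In each case the digit counts follow piecewise linear
   recurrences; their only solutions with C <> D occur when s = 1 and 9 is a digit,
   and these form the stated family. *)

(** * The decimal expansion of k(N) *)

(** For [m > 0] this counts the mirror positions of a sorted [s] whose digits differ by at least
    [m]: the i-th largest and i-th smallest digits do so exactly when some threshold [j] has at
    least i digits [>= j + m] and at least i digits [<= j]. The formula sees digit counts only. *)
Definition overlap (s : seq nat) m :=
  \max_(j < 10) minn (count (leq (j + m)) s) (count (geq j) s).

(** Thresholds [j] with [b <= j <= a - m] gain one in both counts from the outer pair; for every
    other [j] one of the two counts is zero. *)
Lemma overlap_peel a b s m : 0 < m -> a < 10 -> b <= a ->
    all (fun d => b <= d <= a) s ->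
  overlap (a :: rcons s b) m = if m <= a - b then (overlap s m).+1 else 0.
Proof.
move=> m0 a10 ba /allP sab; rewrite /overlap.
have cA j : a < j + m -> count (leq (j + m)) s = 0.
  move=> aj; apply/eqP; rewrite -leqn0 leqNgt -has_count; apply/negP => /hasP[d /sab]; lia.
have cB j : j < b -> count (geq j) s = 0.
  move=> aj; apply/eqP; rewrite -leqn0 leqNgt -has_count; apply/negP => /hasP[d /sab] /=; lia.
case: leqP => mab; last first.
  apply/eqP; rewrite -leqn0; apply/bigmax_leqP => j _.
  rewrite /= -!cats1 !count_cat /=.
  case: (leqP b j) => h1; last by rewrite (cB j) //; lia.
  by rewrite (cA j); lia.
have pk (j : nat) : b <= j -> j + m <= a -> minn (count (leq (j + m)) (a :: rcons s b))
    (count (geq j) (a :: rcons s b)) =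
    (minn (count (leq (j + m)) s) (count (geq j) s)).+1.
  by move=> h1 h2; rewrite /= -!cats1 !count_cat /=; lia.
apply/eqP; rewrite eqn_leq; apply/andP; split.
  apply/bigmax_leqP => j _.
  case: (leqP b j) => h1; last first.
    by rewrite /= -!cats1 !count_cat /= (cB j) //; lia.
  case: (leqP (j + m) a) => h2; last first.
    by rewrite /= -!cats1 !count_cat /= (cA j) //; lia.
  rewrite pk // ltnS; exact: leq_bigmax.
rewrite -/(overlap s m); have [j _ ->] : {j : 'I_10 | true & overlap s m =
    minn (count (leq (j + m)) s) (count (geq j) s)}.
  apply: (@eq_bigmax_cond _ predT (fun j : 'I_10 => minn (count (leq (j + m)) s)
    (count (geq j) s))).
  by rewrite card_ord.
case: (boolP ((b <= j) && (j + m <= a))) => [/andP[h1 h2]|h].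
  rewrite -pk //; exact: leq_bigmax.
have -> : minn (count (leq (j + m)) s) (count (geq j) s) = 0.
  case: (leqP b j) h => h1 /=; last by rewrite (cB j) ?minn0.
  by rewrite -ltnNge => h2; rewrite (cA j) ?min0n.
(* The maximum over [s] is zero here, while the threshold [b] already gives 1 with the outer
   pair. *)
have b10 : b < 10 by lia.
have := pk b (leqnn b) ltac:(lia).
move: (leq_bigmax (F := fun j : 'I_10 => minn (count (leq (j + m)) (a :: rcons s b)) (count
    (geq j) (a :: rcons s b))) (Ordinal b10)).
move=> /= ; lia.
Qed.

(* The decimal expansion of k(N) - 1 for nonempty [dl]: subtracting 1 is the borrow
   made by the next outer pair of digits, which makes the recursion uniform. *)
Fixpoint borrowed (dl : seq nat) x : seq nat :=
  if dl is d :: dl' then (d - (dl' == [::])) :: rcons (borrowed dl' x) (9 - d)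
  else nseq x 9.

Lemma of_digits_cat s t : of_digits (s ++ t) = of_digits s * 10 ^ size t + of_digits t.
Proof.
elim/last_ind: t => [|t d IH]; first by rewrite cats0 /= expn0 muln1 addn0.
rewrite -rcons_cat /of_digits !foldl_rcons -!/(of_digits _) IH size_rcons.
by rewrite expnSr mulnDl mulnA addnA.
Qed.

Lemma of_digits_rcons s d : of_digits (rcons s d) = of_digits s * 10 + d.
Proof. by rewrite /of_digits foldl_rcons. Qed.

Lemma of_digits_cons d s : of_digits (d :: s) = d * 10 ^ size s + of_digits s.
Proof. by rewrite -cat1s of_digits_cat. Qed.

Lemma of_digits_nines x : (of_digits (nseq x 9)).+1 = 10 ^ x.
Proof. by elim: x => //= x IH; rewrite of_digits_cons size_nseq expnS -IH; lia. Qed.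

Lemma size_borrowed dl x : size (borrowed dl x) = x + (size dl).*2.
Proof. by elim: dl => [|d dl IH] /=; rewrite ?size_nseq ?size_rcons ?addn0 // IH; lia. Qed.

(** Outer pairs are peeled off until the two ends agree; [x] digits are then left. The value
    equation is k(N) in additive form. For empty [dl], k(N) is 0 whereas [x] nines plus 1 make
    [10 ^ x], hence the last term. *)
Lemma differences s : sorted geq s -> all (gtn 10) s ->
  exists dl x, [/\ sorted geq dl, all (fun d => 0 < d < 10) dl,
    size s = x + (size dl).*2,
    forall m, 0 < m -> count (leq m) dl = overlap s m &
    of_digits (borrowed dl x) + 1 + of_digits (rev s) = of_digits s + (dl == [::]) * 10 ^
        x].
Proof.
have [k] := ubnP (size s); elim: k s => // k IH [|a s].
  by move=> _ _ _; exists [::], 0; split=> //= m m0; rewrite /overlap big1.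
case/lastP: s => [|s b].
  move=> _ _ _; exists [::], 1; split=> //= [m m0|]; last by rewrite /of_digits /=; lia.
  by rewrite /overlap big1 // => j _ /=; lia.
rewrite /= size_rcons ltnS => sk; rewrite rcons_path all_rcons => /andP[pas lb] /andP[a10
    /andP[b10 s10]].
have trans : transitive geq by move=> x y z /=; lia.
have /allP sa : all (geq a) s by apply: order_path_min pas.
have /allP sb : all (leq b) s.
  apply/allP => d ds; move: pas lb; case/splitPr: ds => s1 s2.
  rewrite cat_path last_cat /= => /andP[_ /andP[_ pd]] lb.
  case/lastP: s2 pd lb => [|s2 e] //.
  rewrite last_rcons rcons_path => /andP[ps2 /= le] be.
  apply: (leq_trans be); apply: (leq_trans le).
  have := order_path_min trans ps2.
  move/allP=> H; case/lastP: s2 {ps2 le} H => [|s2 f] H; first by rewrite leqnn.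
  by rewrite last_rcons; apply: H; rewrite mem_rcons inE eqxx.
have ba : b <= a by case/lastP: s {pas IH sk sb s10 sa} lb (sa) => [|s f] //;
    rewrite last_rcons => bf H; apply: (leq_trans bf); apply: H; rewrite mem_rcons inE eqxx.
have ss : sorted geq s := path_sorted pas.
have [dl [x [sdl adl sz cnt val]]] := IH s (ltnW sk) ss s10.
have sab : all (fun d => b <= d <= a) s.
  by apply/allP => d ds; rewrite sb //=; apply: sa.
have ov m : 0 < m -> overlap (a :: rcons s b) m =
    if m <= a - b then (overlap s m).+1 else 0 by move=> m0; apply: overlap_peel.
case: (ltngtP b a) => [ltba||eab]; [ | lia | ]; last first.
  (* Equal outer digits: the whole list is constant and all of it is left over. *)
  exists [::], (size s).+2; split=> //=; first by lia.
    by move=> m m0; rewrite ov // -eab subnn leqNgt m0.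
  have es : s = nseq (size s) a.
    apply/all_pred1P/allP => d ds; have := sa d ds; have := sb d ds; rewrite /= ; lia.
  rewrite (_ : a :: rcons s b = nseq (size s).+2 a); last first.
    by rewrite eab es size_nseq; congr cons; elim: (size s) => //= p ->.
  rewrite rev_nseq -(of_digits_nines (size s).+2) /=; lia.
have dla : all (fun d => d <= a - b) dl.
  rewrite all_count -(count_predC (leq (a - b).+1) dl) cnt //.
  have -> : overlap s (a - b).+1 = 0.
    apply/eqP; rewrite -leqn0; apply/bigmax_leqP => j _.
    case: (leqP b j) => h.
      rewrite (_ : count (leq (j + (a - b).+1)) s = 0) ?min0n //.
      apply/eqP; rewrite -leqn0 leqNgt -has_count; apply/negP => /hasP[d /sa] /=; lia.
    rewrite (_ : count (geq j) s = 0) ?minn0 //.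
    apply/eqP; rewrite -leqn0 leqNgt -has_count; apply/negP => /hasP[d /sb] /=; lia.
  by rewrite add0n; apply/eqP; apply: eq_count => d /=; lia.
exists ((a - b) :: dl), x; split=> //=.
- by rewrite path_sortedE // sdl andbT; apply: sub_all dla => d /=; lia.
- by rewrite adl andbT; lia.
- lia.
- move=> m m0; rewrite ov // cnt //; case: leqP => h //=.
  rewrite -cnt // add0n; apply/eqP; rewrite -leqn0 leqNgt -has_count;
      apply/negP => /hasP[d]; move/allP: dla => H /H; lia.
rewrite rev_cons rev_rcons rcons_cons !of_digits_cons !of_digits_rcons !size_rcons size_rev
    size_borrowed -sz.
have [e ea] : exists e, a = b + e.+1 by exists (a - b).-1; lia.
rewrite [10 ^ _.+1]expnS ea; have {}a10 : b + e.+1 < 10 by rewrite -ea.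
have -> : b + e.+1 - b = e.+1 by lia.
(* When there is no inner difference, the leading entry lowered by one makes up for the extra
   [10 ^ x] in the induction hypothesis. *)
clear -val sz a10; move: val; case: eqP => [e0|_]; last by rewrite subn0; lia.
have -> : x = size s by rewrite sz e0 /= addn0.
by rewrite subn1 /=; lia.
Qed.

Lemma digitsK s : all (gtn 10) s -> digits (size s) (of_digits s) = s.
Proof.
elim/last_ind: s => [|s d IH] //; rewrite all_rcons => /andP[/= d10 s10].
rewrite /digits size_rcons of_digits_rcons /mkseq /= rev_cons divn1 modnMDl modn_small //.
apply: (congr1 (rcons ^~ d)); rewrite -[RHS]IH // /digits /mkseq; congr (rev _).
rewrite -[1]addn0 iotaDl -map_comp; apply: eq_map => i /=.
by rewrite expnS divnMA divnMDl // (divn_small d10) addn0.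
Qed.

Lemma size_digits n N : size (digits n N) = n.
Proof. by rewrite size_rev size_mkseq. Qed.

Lemma digits_lt10 n N : all (gtn 10) (digits n N).
Proof. by rewrite all_rev; apply/allP => d /mapP[i _ ->] /=; rewrite ltn_mod. Qed.

(** * Digit counts and the effect of k on them *)

Definition count_ge (c : nat -> nat) t := sumn [seq c i | i <- iota t (10 - t)].
Definition count_le (c : nat -> nat) t := sumn [seq c i | i <- iota 0 t.+1].

Lemma count_mem_seq (r s : seq nat) : uniq r ->
  count [in r] s = sumn [seq count_mem i s | i <- r].
Proof.
elim: r => [|a r IH] /=; first by move=> _; rewrite -[RHS](count_pred0 s); apply: eq_count.
move=> /andP[ar /IH <-]; elim: s {IH} => //= d s ->; rewrite inE.
by case: eqP => [->|_] /=; rewrite ?(negbTE ar); lia.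
Qed.

Lemma count_ge_digits s t : all (gtn 10) s ->
  count (leq t) s = count_ge (fun j => count_mem j s) t.
Proof.
move=> /allP s10; rewrite /count_ge -count_mem_seq ?iota_uniq //.
by apply: eq_in_count => d /s10 /= d10; rewrite -[RHS]/(d \in iota _ _) mem_iota; lia.
Qed.

Lemma count_le_digits s t : count (geq t) s = count_le (fun j => count_mem j s) t.
Proof.
rewrite /count_le -count_mem_seq ?iota_uniq //.
by apply: eq_count => d; rewrite -[RHS]/(d \in iota _ _) mem_iota /=; lia.
Qed.

(** Each difference [e] contributes the entries [e] and [9 - e], except that the innermost one
    appears lowered by one; the two indicators move that entry without truncated subtraction. *)
Lemma count_borrowed d dl x j : j < 10 -> all (fun e => 0 < e < 10) (d :: dl) ->
  count_mem j (borrowed (d :: dl) x) + (j == last d dl) =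
  count_mem j (d :: dl) + count_mem (9 - j) (d :: dl) + (j == 9) * x + (j.+1 == last d dl).
Proof.
move=> j10; elim: dl d => [|e dl IH] d.
  by rewrite /= -cats1 count_cat count_nseq /=; lia.
move=> /andP[d10 /IH]; rewrite [last _ (e :: _)]/=.
set l := last e dl.
have -> : borrowed [:: d, e & dl] x = d :: rcons (borrowed (e :: dl) x) (9 - d).
  by rewrite [LHS]/= subn0.
move: (e :: dl) (borrowed _ _) => t B; rewrite /= -cats1 count_cat /=.
lia.
Qed.

(* The number of mirror positions whose digits differ by at least [m], as a function
   of the digit counts [c]; meaningful for [m > 0] only. *)
Definition diffs_ge c m :=
  \max_(j < 10) minn (count_ge c (j + m)) (count_le c j).

(** Positions with difference 0 belong to the leftover digits, which become nines; hence the value 0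
    at [j = 0]. *)
Definition diffs_eq c j := if j is 0 then 0 else diffs_ge c j - diffs_ge c j.+1.

Arguments diffs_eq : simpl never.

(* [d1] and [dr] are the largest and the smallest nonzero differences; the indicators
   on the left-hand side are the entries [dr] and [9 - d1] corrected in k(N). *)
Definition kaprekar_counts n (c c' : nat -> nat) d1 dr := forall j, j < 10 ->
  c' j + (j == dr) + (j + d1 == 9) =
  diffs_eq c j + diffs_eq c (9 - j) + (j == 9) * (n - (diffs_ge c 1).*2) +
  (j.+1 == dr) + (j + d1 == 10).

(** [d1] and [dr] are pinned down by where [diffs_ge c] reaches zero and where it first drops. *)
Definition step n (c c' : nat -> nat) := exists d1 dr,
  [/\ [&& 0 < dr, dr <= d1 & d1 < 10],
      0 < diffs_ge c d1 /\ diffs_ge c d1.+1 = 0,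
      diffs_ge c dr = diffs_ge c 1 /\ diffs_ge c dr.+1 < diffs_ge c dr,
      (diffs_ge c 1).*2 <= n &
      kaprekar_counts n c c' d1 dr].

Lemma kaprekar_step n N : 0 < kaprekar n N ->
  step n (fun j => count_mem j (digits n N)) (fun j => count_mem j (digits n (kaprekar n
      N))).
Proof.
set c := fun j => count_mem j (digits n N).
have geqT : total geq by move=> x y /=; lia.
have asc : sort leq (digits n N) = rev (sort geq (digits n N)).
  apply: (@sorted_eq _ leq leq_trans anti_leq).
  - exact: sort_sorted leq_total _.
  - rewrite rev_sorted; exact: sort_sorted.
  - by rewrite perm_sort perm_sym perm_rev perm_sort.
rewrite /kaprekar /ascending asc /descending.
set s := sort geq (digits n N).
have ss : sorted geq s by exact: sort_sorted.
have s10 : all (gtn 10) s by rewrite all_sort digits_lt10.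
have sn : size s = n by rewrite size_sort size_digits.
have [dl [x [sdl adl sz cnt val]]] := differences _ ss s10.
have cE m : 0 < m -> count (leq m) dl = diffs_ge c m.
  move=> m0; rewrite cnt //; apply: eq_bigr => j _.
  by rewrite !count_sort count_ge_digits ?digits_lt10 // count_le_digits.
clear cnt; case: dl sdl adl sz cE val => [|d dl] sdl adl sz cE val.
  move: val; rewrite /= mul1n addn1 of_digits_nines; lia.
rewrite addn0 in val => _.
have dE : d :: dl = rcons (belast d dl) (last d dl) by rewrite lastI.
(* [K] is [borrowed (d :: dl) x] with its last entry raised by one, which gives k(N) itself. *)
pose K := (d - (dl == [::])) :: rcons (borrowed dl x) (10 - d).
have d10 : 0 < d < 10 by case/andP: adl.
have -> : of_digits s - of_digits (rev s) = of_digits K.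
  rewrite -val addnK /K /= !of_digits_cons !of_digits_rcons !size_rcons; lia.
have K10 : all (gtn 10) K.
  rewrite /K /= all_rcons /=; apply/and3P; split; [lia|lia|].
  have: all (fun e => 0 < e < 10) dl by case/andP: adl.
  elim: (dl) => [_|e dl' IH] /=; first by apply/allP => y /nseqP[->].
  by move=> /andP[e10 /IH h]; rewrite all_rcons h /=; lia.
have Kn : size K = n by rewrite -sn sz /= size_rcons size_borrowed; lia.
rewrite -[in digits _ (of_digits K)]Kn digitsK //.
set dr := last d dl.
have trans : transitive geq by move=> u v w /=; lia.
have dlle : all (geq d) (d :: dl) by rewrite /= leqnn; apply: order_path_min sdl.
have drin : dr \in d :: dl by exact: mem_last.
have drle : all (leq dr) (d :: dl).
  rewrite dE all_rcons leqnn /=; apply/allP => e.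
  have: sorted leq (rev (d :: dl)) by rewrite rev_sorted.
  rewrite dE rev_rcons /= => /(order_path_min leq_trans); rewrite all_rev; move/allP; exact.
have pE j : j < 10 -> diffs_eq c j = count_mem j (d :: dl).
  case: j => [_|j _]; first by apply/esym/count_memPn; apply/negP => /(allP adl); lia.
  rewrite /diffs_eq -!cE //; apply/eqP; rewrite -(eqn_add2r (count (leq j.+2) (d :: dl)))
      subnK; last first.
    by apply: sub_count => e /=; lia.
  rewrite -count_predUI [X in _ == _ + X](_ : _ = 0) ?addn0; last first.
    by rewrite -[RHS](count_pred0 (d :: dl)); apply: eq_count => e /=; lia.
  by apply/eqP; apply: eq_count => e /=; lia.
have E1 : diffs_ge c 1 = size (d :: dl).
  by rewrite -cE //; apply/eqP; rewrite -all_count; apply: sub_all adl => e /andP[].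
exists d, dr; split.
- have /andP[-> _] := allP adl _ drin.
  by rewrite (allP dlle _ drin : dr <= d); case/andP: d10 => _ ->.
- rewrite -!cE //; last by case/andP: d10.
  split; first by rewrite -has_count /= leqnn.
  apply/eqP; rewrite -leqn0 leqNgt -has_count; apply/negP => /hasP[e /(allP dlle)] /=; lia.
- have dr0 : 0 < dr by have /andP[] := allP adl _ drin.
  have cs : count (leq dr) (d :: dl) = size (d :: dl) by apply/eqP; rewrite -all_count.
  rewrite E1 -!cE // cs; split=> //; rewrite ltn_neqAle -all_count count_size andbT.
  by apply/negP => /allP/(_ _ drin); rewrite ltnn.
- by rewrite E1 -sn sz; lia.
move=> j j10; have := count_borrowed _ _ x _ j10 adl.
rewrite !pE //; last by lia.
rewrite E1 -sn sz -/dr addnK.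
have : count_mem j K + (9 - d == j) = count_mem j (borrowed (d :: dl) x) + (10 - d == j).
  by rewrite /K /= -!cats1 !count_cat /= !addn0 -!addnA [(10 - d == j) + _]addnC.
have -> : (9 - d == j) = (j + d == 9) by lia.
have -> : (10 - d == j) = (j + d == 10) by lia.
clear; lia.
Qed.

(** * Digit counts around a 2-cycle *)

Lemma diffs_ge_lb c m j : j < 10 -> minn (count_ge c (j + m)) (count_le c j) <= diffs_ge c
    m.
Proof.
move=> j10; exact: (@leq_bigmax _ (fun j : 'I_10 => minn (count_ge c (j + m)) (count_le c
    j)) (Ordinal j10)).
Qed.

Lemma diffs_ge_ub c m x :
  (forall j, j + m < 10 -> minn (count_ge c (j + m)) (count_le c j) <= x) -> diffs_ge c m
      <= x.
Proof.
move=> H; apply/bigmax_leqP => j _; case: (leqP 10 (j + m)) => jm; last exact: H.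
by rewrite /count_ge (eqP jm) min0n.
Qed.

Lemma count_ge_rec c j : j < 10 -> count_ge c j = c j + count_ge c j.+1.
Proof. by move=> j10; rewrite /count_ge subnS; case: (10 - j) (subn_gt0 j 10) => [|k] /=;
    rewrite j10. Qed.

Lemma count_ge_anti c t t' : t <= t' -> count_ge c t' <= count_ge c t.
Proof.
move=> tt'; case: (leqP 10 t') => h; first by rewrite /count_ge (eqP h).
have [k ->] : exists k, t' = t + k by exists (t' - t); rewrite subnKC.
rewrite /count_ge; case: (leqP 10 (t + k)) => h'; first by rewrite (eqP h').
rewrite (_ : 10 - t = k + (10 - (t + k))); last lia.
by rewrite iotaD map_cat sumn_cat leq_addl.
Qed.

Lemma diffs_ge_anti c m m' : m <= m' -> diffs_ge c m' <= diffs_ge c m.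
Proof.
move=> mm'; apply: diffs_ge_ub => j jm; apply: leq_trans (diffs_ge_lb _ _ j _); last lia.
have := count_ge_anti c (j + m) (j + m'); lia.
Qed.

Lemma count_le_lt c s j : (forall i, i < s -> c i = 0) -> j < s -> count_le c j = 0.
Proof.
move=> c0 js; apply/eqP; rewrite /count_le sumnE big_map big_seq big1 // => i.
rewrite mem_iota => /andP[_ ij]; apply: c0; lia.
Qed.

Lemma count_le_min c s : (forall i, i < s -> c i = 0) -> count_le c s = c s.
Proof.
move=> c0; rewrite /count_le -addn1 iotaD map_cat sumn_cat /= addn0.
case: s c0 => [|s] c0 //; rewrite -/(count_le c s) (count_le_lt _ _ _ c0) //.
Qed.

Definition mirrored n c c' := forall j, j < 10 ->
  c' j = diffs_eq c j + diffs_eq c (9 - j) + (j == 9) * (n - (diffs_ge c 1).*2).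

Definition counts_step n (c c' : nat -> nat) s d1 dr :=
  [/\ s < dr <= d1, d1 + s < 10 /\ 0 < c (d1 + s), forall j, d1 + s < j < 10 -> c j = 0,
   [/\ diffs_ge c dr = diffs_ge c 1, diffs_ge c dr.+1 < diffs_ge c dr,
       diffs_ge c d1.+1 = 0, 0 < diffs_ge c d1 & (diffs_ge c 1).*2 <= n] &
   kaprekar_counts n c c' d1 dr].

(** The largest difference occurs between the largest and the smallest digit, so the former is
    [d1 + s]. The bound [s < dr] holds because the image has no digit below [s]. *)
Lemma step_min n c c' s : step n c c' -> s < 10 ->
    (forall j, j < s -> c j = 0) -> (forall j, j < s -> c' j = 0) ->
    0 < c s -> exists d1 dr, counts_step n c c' s d1 dr.
Proof.
move=> [d1 [dr [/and3P[dr0 drd1 d10] [Ed1 Ed1S] [Edr EdrS] En st]]] s10 c0 c'0 cs.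
have d1s : d1 + s < 10.
  rewrite ltnNge; apply/negP => h; move: Ed1; apply/negP; rewrite -leqNgt.
  apply: diffs_ge_ub => j jm; rewrite (count_le_lt _ _ _ c0) ?minn0 //; lia.
have pd1 : 0 < diffs_eq c d1 by case: d1 {st d1s d10 drd1} Ed1 Ed1S => [|k];
    rewrite /diffs_eq; [rewrite ?Edr|]; lia.
have sdr : s < dr.
  rewrite ltnNge; apply/negP => h.
  (* The corrected entry [dr - 1 < s] would be a digit of the image. Even if [dr - 1 = 9 - d1], so
     that one copy is removed, the difference [d1] supplies another. *)
  have := st dr.-1 ltac:(lia); rewrite c'0; last lia.
  have [e|e] := eqVneq (dr.-1 + d1) 9; last by clear -dr0 e; lia.
  have -> : 9 - dr.-1 = d1 by lia.
  by clear -dr0 e pd1; lia.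
have cls : 0 < count_le c s by rewrite count_le_min.
have cg0 : count_ge c (d1 + s).+1 = 0.
  by have := diffs_ge_lb c d1.+1 s s10; rewrite Ed1S addnS [s + d1]addnC; lia.
exists d1, dr; split; rewrite ?sdr //.
- split=> //; rewrite lt0n; apply/eqP => cz; move: Ed1; apply/negP; rewrite -leqNgt.
  apply: diffs_ge_ub => j jm; case: (ltngtP j s) => js.
  + by rewrite (count_le_lt _ _ _ c0 js) minn0.
  + by have := count_ge_anti c (d1 + s).+1 (j + d1); lia.
  + by rewrite js addnC count_ge_rec // cz cg0 min0n.
- move=> j /andP[j1 j2]; have := count_ge_anti c _ _ j1; rewrite cg0 count_ge_rec //; lia.
Qed.

(* When [d1 = 10 - dr] the two corrections cancel. *)
Lemma mirrored_intro n c c' d1 dr :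
   dr + d1 = 10 ->
   kaprekar_counts n c c' d1 dr ->
  mirrored n c c'.
Proof.
move=> e st j j10; have := st j j10.
by clear -e; lia.
Qed.

Lemma diffs_ge10 c : diffs_ge c 10 = 0.
Proof. by apply/eqP; rewrite -leqn0; apply: diffs_ge_ub => j; lia. Qed.

Lemma sum_diffs_eq c :
  diffs_eq c 1 + diffs_eq c 2 + diffs_eq c 3 + diffs_eq c 4 + diffs_eq c 5 + diffs_eq c 6 +
      diffs_eq c 7 + diffs_eq c 8 + diffs_eq c 9 = diffs_ge c 1.
Proof.
have S j := diffs_ge_anti c _ _ (leqnSn j).
have := diffs_ge10 c.
move: (S 1) (S 2) (S 3) (S 4) (S 5) (S 6) (S 7) (S 8) (S 9); rewrite /diffs_eq; clear; lia.
Qed.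

(** The number of leftover digits cannot grow in the next step: threshold 4 pairs every digit of
    [c'] below 5 with one above 4, so [c'] has at least as many nonzero differences as [c]. *)
Lemma mirroredP n c c' : mirrored n c c' -> (diffs_ge c 1).*2 <= n ->
  [/\ c' 8 = c' 1, c' 7 = c' 2, c' 6 = c' 3, c' 5 = c' 4 &
    [/\ c' 9 = c' 0 + (n - (diffs_ge c 1).*2), count_ge c' 0 = n & n - (diffs_ge c' 1).*2
        <= n - (diffs_ge c 1).*2]].
Proof.
move=> sym En; have := diffs_ge_lb c' 1 4 isT; have := sum_diffs_eq c.
move: (sym 0 isT) (sym 1 isT) (sym 2 isT) (sym 3 isT) (sym 4 isT) (sym 5 isT)
  (sym 6 isT) (sym 7 isT) (sym 8 isT) (sym 9 isT).
rewrite !subSS !subn0; have -> : diffs_eq c 0 = 0 by [].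
move: En; rewrite /count_ge /count_le /=; clear.
move: (diffs_ge c 1) (diffs_ge c' 1) (diffs_eq c 1) (diffs_eq c 2) (diffs_eq c 3) (diffs_eq
    c 4) (diffs_eq c 5) (diffs_eq c 6) (diffs_eq c 7) (diffs_eq c 8) (diffs_eq c 9).
move: (c' 0) (c' 1) (c' 2) (c' 3) (c' 4) (c' 5) (c' 6) (c' 7) (c' 8) (c' 9).
move=> c0 c1 c2 c3 c4 c5 c6 c7 c8 c9 E1 E1' p1 p2 p3 p4 p5 p6 p7 p8 p9 En.
rewrite !mul0n !addn0 !add0n mul1n.
do 10![move=> ->]; move=> hE hE'.
repeat split; lia.
Qed.

(** Apart from the corrections, an entry [s] of the image comes from a difference [9 - s], which
    only a 9 facing an [s] can give; a difference [s] is excluded by [s < dr]. *)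
Lemma counts_step_min_digit n c c' s d1 dr : counts_step n c c' s d1 dr ->
  (forall j, j < s -> c j = 0) ->
  diffs_eq c (9 - s) = minn (c 9) (c s) /\
  c' s + (s + d1 == 9) = minn (c 9) (c s) + (dr == s.+1).
Proof.
move=> [/andP[sdr drd1] [d1s _] _ [Edr EdrS Ed1S Ed1 En] st] c0.
have s9 : s < 9 by lia.
have E9 : diffs_ge c (9 - s) = minn (c 9) (c s).
  apply/eqP; rewrite eqn_leq; apply/andP; split.
    apply: diffs_ge_ub => j jm; case: (ltngtP j s) => js;
        first by rewrite (count_le_lt _ _ _ c0 js) minn0.
    - lia.
    - by rewrite js subnKC ?[s <= 9]ltnW // count_le_min // /count_ge /= addn0.
  have := diffs_ge_lb c (9 - s) s (ltnW s9).
  by rewrite subnKC ?[s <= 9]ltnW // count_le_min // /count_ge /= addn0.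
have p9 : diffs_eq c (9 - s) = minn (c 9) (c s).
  rewrite -E9 -[9 - s]prednK ?subn_gt0 // /diffs_eq prednK ?subn_gt0 //.
  by have := diffs_ge_anti c d1.+1 (9 - s).+1 ltac:(lia); rewrite Ed1S; lia.
split=> //; have := st s (ltnW s9); rewrite p9.
have -> : diffs_eq c s = 0.
  case: (s) sdr => // k kdr; rewrite /diffs_eq.
  by have := diffs_ge_anti c 1 k.+1 isT; have := diffs_ge_anti c k.+2 dr kdr; lia.
have -> : (s == dr) = false by lia.
have -> : (s == 9) = false by lia.
have -> : (s + d1 == 10) = false by lia.
by rewrite mul0n; lia.
Qed.

Lemma top_nine (c : nat -> nat) t :
  0 < c 9 -> t < 10 -> (forall j, t < j < 10 -> c j = 0) -> t = 9.
Proof.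
move=> c9 t10 H; apply/eqP; rewrite eqn_leq -ltnS t10 leqNgt; apply/negP => t9.
by rewrite H ?t9 in c9.
Qed.

(* Counting the smallest digit [s], then the digit 9, around the cycle. *)
Lemma no_nine n c d s a1 ar b1 br :
  counts_step n c d s a1 ar -> counts_step n d c s b1 br ->
  (forall j, j < s -> c j = 0) -> (forall j, j < s -> d j = 0) ->
  0 < c s -> 0 < d s -> c 9 = 0 ->
  [/\ ar = s.+1, d s = 1, a1 + s < 9, n = (diffs_ge d 1).*2 & diffs_eq d 9 = 0].
Proof.
move=> sc sd c0 d0 cs ds c9.
have [_ ec] := counts_step_min_digit _ _ _ _ _ _ sc c0.
move: (sc) (sd) => [/andP[sar ara1] [a1s ca1] _ _ _]
  [/andP[sbr brb1] [b1s db1] _ [_ _ _ _ End] std].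
have a1s9 : a1 + s < 9.
  by rewrite ltn_neqAle -ltnS a1s andbT; apply/eqP => e; rewrite e c9 in ca1.
move: ec; rewrite c9 min0n => ec.
have [ars ds1] : ar = s.+1 /\ d s = 1 by clear -ec ds a1s9; lia.
(* Since [c 9 = 0], [d] has no difference 9 and no leftover digit, unless a 9 is corrected away
   because [br = 9]. In that case [s = 0], and counting zeros gives [c 0 = 0]. *)
have := std 9 isT; rewrite c9 subnn (_ : diffs_eq d 0 = 0) // mul1n => h9.
have br9 : br != 9.
  apply/eqP => e; have b9 : b1 = 9 by lia.
  have s0 : s = 0 by lia.
  have := std 0 isT; rewrite s0 in cs; rewrite subn0 (_ : diffs_eq d 0 = 0) // mul0n e b9.
  by rewrite e b9 in h9; clear -h9 cs; lia.
split=> //; clear -h9 br9 End sbr brb1; lia.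
Qed.

Lemma two_cycle_cases n c d s a1 ar b1 br :
  counts_step n c d s a1 ar -> counts_step n d c s b1 br ->
  (forall j, j < s -> c j = 0) -> (forall j, j < s -> d j = 0) ->
  0 < c s -> 0 < d s ->
  [/\ ar = s.+1, br = s.+1, mirrored n c d, mirrored n d c &
    [/\ c s = d s, c s <= c 9 & d s <= d 9]] \/
  [/\ ar = s.+1, br = s.+1, c 9 = 0, d 9 = 0 &
   [/\ c s = 1, d s = 1, n = (diffs_ge c 1).*2 & n = (diffs_ge d 1).*2]].
Proof.
have half : forall c d a1 ar b1 br, counts_step n c d s a1 ar -> counts_step n d c s b1 br
    ->
    (forall j, j < s -> c j = 0) -> (forall j, j < s -> d j = 0) ->
    0 < c s -> 0 < d s -> c 9 = 0 -> d 9 = 0.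
  (* If [d] has a 9, the step from [d] to [c] is mirrored and [c] has no leftover digits. So the 9
     can only be the corrected entry [10 - a1] with [a1 = 1]; then [s = 0] and [d] has a difference
     9, which [no_nine] excludes. *)
  move=> {}c {}d {}a1 {}ar {}b1 {}br sc sd c0 d0 cs ds c9; apply/eqP/negP => /negP;
      rewrite -lt0n => d9.
  have [ars ds1 a1s9 nd pd9] := no_nine _ _ _ _ _ _ _ _ sc sd c0 d0 cs ds c9.
  have [pd ed] := counts_step_min_digit _ _ _ _ _ _ sd d0.
  move: (sc) (sd) => [/andP[_ ara1] _ _ [_ _ Ea1S _ _] stc] [_ [b1s _] dgt [_ _ _ _ End]
      std].
  have b1s9 : b1 + s = 9.
    exact: (top_nine _ _ d9 b1s dgt).
  have brs : br = s.+1 by clear -ed b1s9 cs ds1; lia.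
  have mir : mirrored n d c by apply: mirrored_intro std; lia.
  have [_ _ _ _ [_ _]] := mirroredP _ _ _ mir End.
  have := stc 9 isT; rewrite subnn (_ : diffs_eq c 0 = 0) // mul1n.
  have -> : diffs_eq c 9 = 0 by rewrite /diffs_eq;
      have := diffs_ge_anti c a1.+1 9 ltac:(lia); rewrite Ea1S; clear; lia.
  rewrite -nd subnn; case: (eqVneq a1 1) => [a1e|]; last by clear -d9 a1s9 ara1 ars; lia.
  have s0 : s = 0 by lia.
  by move: pd; rewrite s0 subn0 pd9; rewrite s0 in ds1; lia.
move=> sc sd c0 d0 cs ds.
have [pc ec] := counts_step_min_digit _ _ _ _ _ _ sc c0.
have [pd ed] := counts_step_min_digit _ _ _ _ _ _ sd d0.
have [c9|c9] := posnP (c 9).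
  have d9 := half _ _ _ _ _ _ sc sd c0 d0 cs ds c9.
  have [? ? _ ? _] := no_nine _ _ _ _ _ _ _ _ sc sd c0 d0 cs ds c9.
  by have [? ? _ ? _] := no_nine _ _ _ _ _ _ _ _ sd sc d0 c0 ds cs d9; right.
have [d9|d9] := posnP (d 9).
  by have := half _ _ _ _ _ _ sd sc d0 c0 ds cs d9; lia.
move: sc sd => [_ [a1s _] cgt _ stc] [_ [b1s _] dgt _ std].
have a1s9 : a1 + s = 9.
  exact: (top_nine _ _ c9 a1s cgt).
have b1s9 : b1 + s = 9.
  exact: (top_nine _ _ d9 b1s dgt).
have [ars brs cds] : [/\ ar = s.+1, br = s.+1 & c s = d s].
  by clear -ec ed a1s9 b1s9 cs ds c9 d9; split; lia.
left; split=> //; [apply: mirrored_intro stc|apply: mirrored_intro std|]; try lia.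
clear -cds ec ed a1s9 b1s9 ars brs; split=> //; lia.
Qed.

(** * Cycles containing the digit 9 *)

Definition palindromic (c : nat -> nat) z :=
  [/\ c 5 = c 4, c 6 = c 3, c 7 = c 2, c 8 = c 1 & c 9 = c 0 + z].

Ltac cut_sums := rewrite ?addSn ?add0n /count_ge /count_le /=.

Ltac bound_overlaps := apply: diffs_ge_ub; do 10?[case=> [_|]];
  [.. | by move=> ?; rewrite !addSn]; cut_sums.

(* Proves [diffs_ge c m = x], where the maximum over [j] is reached at [j1] or [j2]. *)
Ltac diffs_ge_max2 j1 j2 :=
  let c := lazymatch goal with |- diffs_ge ?c _ = _ => c end in
  let m := lazymatch goal with |- diffs_ge _ ?m = _ => m end in
  apply/eqP; rewrite eqn_leq; apply/andP; split;
  [ bound_overlaps; repeat match goal with H : c _ = _ |- _ => rewrite !H end; lia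
  | have := diffs_ge_lb c m j1 isT; have := diffs_ge_lb c m j2 isT; cut_sums;
    repeat match goal with H : c _ = _ |- _ => rewrite !H end; lia ].

(* In [palindromicN_image] and [palindromicN_cycle], N is the smallest digit, [a] holds
   the digit counts of the image under k, and [z] is the number of extra nines. *)
Lemma diffs_palindromic1 c z : palindromic c z -> c 0 = 0 -> c 1 <= z -> 0 < c 1 ->
    diffs_ge c 1 = count_le c 4 -> diffs_ge c 2 = diffs_ge c 1 ->
    diffs_ge c 3 < diffs_ge c 2 ->
  [/\ c 4 = z, 0 < c 3,
   diffs_ge c 3 = c 1 + c 2 + maxn (c 3) z,
   diffs_ge c 4 = c 1 + maxn (c 2 + minn z (c 3)) z &
   [/\ diffs_ge c 6 = maxn (c 1 + minn z (c 2)) (minn z (c 1 + c 2 + c 3)),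
     diffs_ge c 7 = minn z (c 1 + c 2) & diffs_ge c 8 = c 1]].
Proof.
move=> [c5 c6 c7 c8 c9] c0 c1z c1p.
have := diffs_ge_lb c 1 4 isT; have := diffs_ge_lb c 1 5 isT.
have := diffs_ge_lb c 3 3 isT; have := diffs_ge_lb c 3 4 isT.
move=> g34 g33 g15 g14 E1 E2 E3; move: g34 g33 g15 g14; rewrite E2 E1 in E3; move: E3;
    rewrite E1.
cut_sums; rewrite !addn0 c5 c6 c7 c8 c9 c0 !add0n => E3 g34 g33 g15 g14.
(* Differences of at least 3 and of at least 1 give [z <= c 4]; the bound on differences of at least
   2 below gives the converse. *)
have z4 : z <= c 4 by clear -g34 g33 g15 g14 E3; lia.
have z34 : z < c 3 + c 4 by clear -g34 g33 g15 g14 E3; lia.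
have low2 : diffs_ge c 2 <= c 1 + c 2 + c 3 + z.
  bound_overlaps; rewrite ?c5 ?c6 ?c7 ?c8 ?c9 ?c0; clear -z4 z34; lia.
have {}z4 : c 4 = z.
  by clear E3 g34 g33 g15 g14; move: low2; rewrite E2 E1; cut_sums; rewrite c0; clear -z4; lia.
have {}z34 : 0 < c 3 by clear -z4 z34; lia.
clear -z4 z34 c5 c6 c7 c8 c9 c0 c1z.
split=> //; [diffs_ge_max2 3 4|diffs_ge_max2 3 4|split;
    [diffs_ge_max2 2 3|diffs_ge_max2 2 2|diffs_ge_max2 1 1]].
Qed.

Lemma palindromic1_image c a z : palindromic c z -> c 0 = 0 -> c 1 <= z -> 0 < c 1 ->
    diffs_ge c 1 = count_le c 4 -> diffs_ge c 2 = diffs_ge c 1 ->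
    diffs_ge c 3 < diffs_ge c 2 ->
    a 4 = diffs_eq c 4 + diffs_eq c 5 -> a 2 = diffs_eq c 2 + diffs_eq c 7 -> z <= a 4 ->
  c 4 = z /\
  [\/ [/\ z <= c 3, c 2 = a 4 & a 2 = 2 * z - c 1],
     [/\ z <= c 3, c 2 < z <= c 1 + c 2, a 4 = z & a 2 = 2 * z - c 1],
     [/\ c 3 < z, z <= c 2, a 4 = c 2 + c 3 - z & a 2 = c 3 + z - c 1] |
     [/\ c 3 < z, c 2 = 0, a 4 = z & a 2 = c 3]].
Proof.
move=> pal c0 c1z c1p E1 E2 E3.
have [c4 c3p E3e E4e [E6e E7e E8e]] := diffs_palindromic1 _ _ pal c0 c1z c1p E1 E2 E3.
move=> a4e a2e; have {}a4e : a 4 = diffs_ge c 4 - diffs_ge c 6.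
  by rewrite a4e /diffs_eq; have := diffs_ge_anti c 4 5 isT;
      have := diffs_ge_anti c 5 6 isT; clear; lia.
move: a4e a2e; rewrite /diffs_eq E2 E1 E3e E4e E6e E7e E8e /count_le /= c0 c4.
move: (c 1) (c 2) (c 3) (a 4) (a 2) c1z c1p c3p => w c2 c3 a4 a2.
clear; case: (leqP z c3) => z3; case: (leqP z c2) => z2 wz w0 c3p e4 e2 a4z; split=> //.
- by apply: Or41; split=> //; lia.
- by apply: Or42; split=> //; lia.
- by apply: Or43; split=> //; lia.
(* With both [c 2] and [c 3] below [z], the hypothesis [z <= a 4] forces [c 2 = 0]. *)
- by apply: Or44; split=> //; lia.
Qed.

Lemma palindromic1_cycle c a z : palindromic c z -> palindromic a z ->
    c 0 = 0 -> a 0 = 0 -> c 1 = a 1 -> c 1 <= z -> 0 < c 1 ->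
    count_le c 4 = count_le a 4 ->
    diffs_ge c 1 = count_le c 4 -> diffs_ge c 2 = diffs_ge c 1 ->
    diffs_ge c 3 < diffs_ge c 2 ->
    diffs_ge a 1 = count_le a 4 -> diffs_ge a 2 = diffs_ge a 1 ->
    diffs_ge a 3 < diffs_ge a 2 ->
    a 4 = diffs_eq c 4 + diffs_eq c 5 -> a 2 = diffs_eq c 2 + diffs_eq c 7 ->
    c 4 = diffs_eq a 4 + diffs_eq a 5 -> c 2 = diffs_eq a 2 + diffs_eq a 7 -> c 2 <> a 2 ->
  [/\ c 4 = z, a 4 = z, c 2 + c 3 = 2 * z, a 2 + a 3 = 2 * z &
   [/\ z <= c 2 , z <= a 2 & c 1 + c 2 + a 2 = 3 * z]].
Proof.
move=> palc pala c0 a0 e1 c1z c1p eh Ec1 Ec2 Ec3 Ea1 Ea2 Ea3 a4 a2 c4 c2 ne.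
have a1z : a 1 <= z by rewrite -e1. have a1p : 0 < a 1 by rewrite -e1.
have c4z : c 4 = z.
  have [+ _] := diffs_palindromic1 _ _ palc c0 c1z c1p Ec1 Ec2 Ec3; exact.
have a4z : a 4 = z.
  have [+ _] := diffs_palindromic1 _ _ pala a0 a1z a1p Ea1 Ea2 Ea3; exact.
have := palindromic1_image _ a _ palc c0 c1z c1p Ec1 Ec2 Ec3 a4 a2 ltac:(lia).
have := palindromic1_image _ c _ pala a0 a1z a1p Ea1 Ea2 Ea3 c4 c2 ltac:(lia).
move: eh; move: ne; rewrite /count_le /= c0 a0 e1 c4z a4z; clear -a1z a1p.
move: (c 2) (c 3) (a 1) (a 2) (a 3) a1z a1p => c2 c3 w a2 a3 wz w0 ne eh [_ C] [_ A].
(* Only the third case on both sides, or the first facing the third, is compatible with [c2 <> a2]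
   and equal totals. *)
case: C => [[? ? ?]|[? ? ? ?]|[? ? ? ?]|[? ? ? ?]];
case: A => [[? ? ?]|[? ? ? ?]|[? ? ? ?]|[? ? ? ?]];
  try (exfalso; lia); repeat split; try lia.
Qed.

(** Used for smallest digit 0, with smallest difference 1. Threshold 4 for differences of at least 2
    gives [z < c 4], and the assumed gap between [diffs_ge c 4] and [diffs_ge c 6] gives [z < c 2];
    these decide each maximum. *)
Lemma diffs_palindromic0 c z : palindromic c z ->
    diffs_ge c 1 = count_le c 4 -> diffs_ge c 2 < diffs_ge c 1 -> z + diffs_ge c 6 <
        diffs_ge c 4 ->
  [/\ z < c 4, diffs_ge c 2 = z + count_le c 3, diffs_ge c 3 = count_le c 2 + maxn (c 3) z,
   diffs_ge c 4 + z = count_le c 1 + z + c 2 + minn z (c 3) &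
   [/\ diffs_ge c 6 = z + count_le c 1,
     diffs_ge c 7 = c 0 + maxn (c 1) (minn z (c 1 + c 2)),
     diffs_ge c 8 = c 0 + minn z (c 1) & diffs_ge c 9 = c 0]].
Proof.
move=> [c5 c6 c7 c8 c9].
have := diffs_ge_lb c 2 4 isT.
move=> g24 E1 E2 E64; rewrite E1 in E2; move: (leq_ltn_trans g24 E2).
cut_sums; rewrite !addn0 ?c5 ?c6 ?c7 ?c8 ?c9 => g.
have z4 : z < c 4 by clear -g; lia.
have E4 : diffs_ge c 4 = c 0 + c 1 + maxn (minn (z + c 2) (c 2 + c 3)) z.
  by clear -z4 c5 c6 c7 c8 c9; diffs_ge_max2 3 4.
have E6 : diffs_ge c 6 = c 0 + maxn (c 1) (maxn (c 1 + minn z (c 2)) (minn z (c 1 + c 2 + c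
    3))).
  clear -z4 c5 c6 c7 c8 c9. diffs_ge_max2 2 3.
have z2 : z < c 2.
  by move: E64; rewrite E4 E6; clear; lia.
rewrite E4 E6; move: E64; rewrite E4 E6 => {E4 E6} E64.
split; [done| | | |split]; try (clear -z2 E64; lia); clear -z4 z2 c5 c6 c7 c8 c9.
- diffs_ge_max2 4 4.
- diffs_ge_max2 3 4.
- diffs_ge_max2 1 2.
- diffs_ge_max2 1 1.
- diffs_ge_max2 0 0.
Qed.

Lemma palindromic0_image c a z : palindromic c z ->
    diffs_ge c 1 = count_le c 4 -> diffs_ge c 2 < diffs_ge c 1 -> z < a 4 ->
    a 1 = diffs_eq c 1 + diffs_eq c 8 -> a 2 = diffs_eq c 2 + diffs_eq c 7 ->
    a 4 = diffs_eq c 4 + diffs_eq c 5 ->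
  [/\ z < c 4, a 4 + z = c 2 + minn z (c 3), a 1 + z = c 4 + minn z (c 1) &
      a 2 = minn z (c 3) + (maxn (c 1) z - minn z (c 1)) ].
Proof.
move=> pal E1 E2 za a1 a2 a4.
have {}a4 : a 4 = diffs_ge c 4 - diffs_ge c 6.
  by rewrite a4 /diffs_eq; have := diffs_ge_anti c 4 5 isT;
      have := diffs_ge_anti c 5 6 isT; clear; lia.
have [z4 E2e E3e E4e [E6e E7e E8e E9e]] := diffs_palindromic0 _ _ pal E1 E2 ltac:(lia).
have c2z : z < c 2.
  by move: a4 za E4e; rewrite E6e /count_le /=; clear; lia.
move: a1 a2 a4 E4e; rewrite /diffs_eq E1 E2e E3e E6e E7e E8e E9e /count_le /=.
move: (diffs_ge c 4) za z4 c2z; clear; move=> e za z4 c2z a1 a2 a4 ee.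
split; lia.
Qed.

Lemma palindromic0_cycle c a z : palindromic c z -> palindromic a z ->
    c 0 = a 0 -> count_le c 4 = count_le a 4 ->
    diffs_ge c 1 = count_le c 4 -> diffs_ge c 2 < diffs_ge c 1 ->
    diffs_ge a 1 = count_le a 4 -> diffs_ge a 2 < diffs_ge a 1 ->
    a 1 = diffs_eq c 1 + diffs_eq c 8 -> a 2 = diffs_eq c 2 + diffs_eq c 7 ->
    a 4 = diffs_eq c 4 + diffs_eq c 5 ->
    c 1 = diffs_eq a 1 + diffs_eq a 8 -> c 2 = diffs_eq a 2 + diffs_eq a 7 ->
    c 4 = diffs_eq a 4 + diffs_eq a 5 ->
  [/\ c 1 = a 1, c 2 = a 2, c 3 = a 3 & c 4 = a 4].
Proof.
move=> palc pala e0 eh Ec1 Ec2 Ea1 Ea2 a1 a2 a4 c1 c2 c4.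
have z4 (b : nat -> nat) : palindromic b z -> diffs_ge b 1 = count_le b 4 -> diffs_ge b 2 <
    diffs_ge b 1 -> z < b 4.
  move=> [b5 b6 b7 b8 b9] E1 E2; rewrite E1 in E2.
  move: (leq_ltn_trans (diffs_ge_lb b 2 4 isT) E2); cut_sums; rewrite ?b6 ?b7 ?b8 ?b9;
      clear; lia.
have [_ {}a4 {}a1 {}a2] := palindromic0_image _ a _ palc Ec1 Ec2 (z4 _ pala Ea1 Ea2) a1 a2
    a4.
have [_ {}c4 {}c1 {}c2] := palindromic0_image _ c _ pala Ea1 Ea2 (z4 _ palc Ec1 Ec2) c1 c2
    c4.
move: eh a1 a2 a4 c1 c2 c4 (z4 _ palc Ec1 Ec2) (z4 _ pala Ea1 Ea2);
    rewrite /count_le /= e0 !addn0.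
move: (c 1) (c 2) (c 3) (c 4) (a 1) (a 2) (a 3) (a 4); clear.
move=> c1 c2 c3 c4 a1 a2 a3 a4.
(* Comparing these counts with [z] makes the recurrences linear, and in every case they have fixed
   points only. *)
case: (leqP z c1) => zc1; case: (leqP z c3) => zc3;
case: (leqP z a1) => za1; case: (leqP z a3) => za3;
move=> *; split; lia.
Qed.

Lemma palindromic2_image c a z : palindromic c z -> c 0 = 0 -> c 1 = 0 ->
    0 < c 2 <= z ->
    diffs_ge c 1 = count_le c 4 -> diffs_ge c 3 = diffs_ge c 1 ->
    diffs_ge c 4 < diffs_ge c 3 ->
    a 4 = diffs_eq c 4 + diffs_eq c 5 ->
  [/\ z <= c 4 \/ c 4 = 0, c 4 = 0 \/ c 3 + c 4 <= z, c 4 = 0 -> z < c 3 &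
   a 4 = maxn (c 2 + minn z (c 3)) z - minn z (c 2 + c 3)].
Proof.
move=> [c5 c6 c7 c8 c9] c0 c1 /andP[c2p c2z] E1 E3 E4 a4.
have {}a4 : a 4 = diffs_ge c 4 - diffs_ge c 6.
  by rewrite a4 /diffs_eq; have := diffs_ge_anti c 4 5 isT;
      have := diffs_ge_anti c 5 6 isT; clear; lia.
(* Three thresholds from below and one bound from above, for differences of at least 3, confine
   [c 3] and [c 4] relative to [z]. *)
have g15 := diffs_ge_lb c 1 5 isT; rewrite E1 in g15.
move: E4; rewrite E3 E1 => E4.
have g43 := leq_ltn_trans (diffs_ge_lb c 4 3 isT) E4.
have g44 := leq_ltn_trans (diffs_ge_lb c 4 5 isT) E4.
have u3 : diffs_ge c 3 <= maxn (c 2 + maxn (c 3) (minn z (c 3 + c 4))) z.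
  bound_overlaps; rewrite ?c5 ?c6 ?c7 ?c8 ?c9 ?c0 ?c1; clear; lia.
move: g15 g43 g44 u3; rewrite E3 E1; clear E1 E3 E4; cut_sums;
 rewrite ?c5 ?c6 ?c7 ?c8 ?c9 ?c0 ?c1 !addn0 !add0n => g15 g43 g44 u3.
split.
- lia.
- lia.
- lia.
rewrite a4; congr subn; clear -g44 g43 c5 c6 c7 c8 c9 c0 c1 c2z. diffs_ge_max2 3 5.
    diffs_ge_max2 2 3.
Qed.

Lemma palindromic2_cycle c a z : palindromic c z -> palindromic a z ->
    c 0 = 0 -> a 0 = 0 -> c 1 = 0 -> a 1 = 0 -> c 2 = a 2 -> 0 < c 2 <= z ->
    count_le c 4 = count_le a 4 ->
    diffs_ge c 1 = count_le c 4 -> diffs_ge c 3 = diffs_ge c 1 ->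
    diffs_ge c 4 < diffs_ge c 3 ->
    diffs_ge a 1 = count_le a 4 -> diffs_ge a 3 = diffs_ge a 1 ->
    diffs_ge a 4 < diffs_ge a 3 ->
    a 4 = diffs_eq c 4 + diffs_eq c 5 -> c 4 = diffs_eq a 4 + diffs_eq a 5 ->
  c 3 = a 3 /\ c 4 = a 4.
Proof.
move=> palc pala c0 a0 c1 a1 e2 c2z eh Ec1 Ec3 Ec4 Ea1 Ea3 Ea4 a4 c4.
have a2z : 0 < a 2 <= z by rewrite -e2.
have [C1 C2 C3 {}a4] := palindromic2_image _ a _ palc c0 c1 c2z Ec1 Ec3 Ec4 a4.
have [A1 A2 A3 {}c4] := palindromic2_image _ c _ pala a0 a1 a2z Ea1 Ea3 Ea4 c4.
move: eh a2z C1 C2 C3 A1 A2 A3 a4 c4; rewrite /count_le /= c0 c1 a0 a1 e2.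
by move: (a 2) (c 3) (c 4) (a 3) (a 4); clear; move=> *; split; lia.
Qed.

(** * Cycles without the digit 9 *)

Lemma diffs_eq0_hi c m t : diffs_ge c m = 0 -> m <= t -> diffs_eq c t = 0.
Proof.
move=> Em mt; have := diffs_ge_anti c m t mt; rewrite Em leqn0 => /eqP Et.
by case: t mt Et => // t _ Et; rewrite /diffs_eq Et.
Qed.

Lemma diffs_eq0_lo c m t : diffs_ge c m = diffs_ge c 1 -> t < m -> diffs_eq c t = 0.
Proof.
case: t => // t Em tm; rewrite /diffs_eq.
by have := diffs_ge_anti c 1 t.+1 isT; have := diffs_ge_anti c t.+2 m tm; rewrite Em;
    clear; lia.
Qed.

(** The smallest difference [s.+1] of [d] puts the digit [8 - s] into [c], or [9 - s] if it is also
    the largest difference and gets corrected. *)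
Lemma top_diff_ge n c d s a1 b1 :
  counts_step n d c s b1 s.+1 -> (forall j, a1 + s < j < 10 -> c j = 0) ->
  a1 + s < 9 -> b1 + s < 9 -> s < a1 -> 8 <= a1 + s.*2.
Proof.
move=> [/andP[_ sb1] _ _ [Es EsS _ _ _] std] cgt a1s b1s sa1; rewrite leqNgt;
    apply/negP => lt8.
have ps : 0 < diffs_eq d s.+1 by rewrite /diffs_eq; clear -EsS; lia.
have [b1e|b1e] := eqVneq b1 s.+1.
  have := std (9 - s) ltac:(lia); rewrite cgt; last by clear -lt8; lia.
  have -> : (9 - s == s.+1) = false by clear -lt8 sa1; lia.
  have -> : (9 - s + b1 == 9) = false by clear -a1s b1e; lia.
  have -> : (9 - s + b1 == 10) = true by clear -a1s b1e; lia.
  by clear; lia.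
have := std (8 - s) ltac:(lia); rewrite cgt; last by clear -lt8; lia.
rewrite (_ : 9 - (8 - s) = s.+1); last by clear -a1s; lia.
have -> : (8 - s == s.+1) = false by clear; lia.
have -> : (8 - s + b1 == 9) = false by clear -b1e a1s; lia.
by clear -ps; lia.
Qed.

(** A digit [a1 + s] above [8 - s] would exceed every difference of [d], its complement to 9 would
    lie below every nonzero one, and neither correction produces it. *)
Lemma top_diff_le n c d s a1 b1 :
  counts_step n d c s b1 s.+1 -> 0 < c (a1 + s) ->
  a1 + s < 9 -> b1 + s < 9 -> s < a1 -> 8 <= b1 + s.*2 -> a1 + s.*2 <= 8.
Proof.
move=> [/andP[_ sb1] _ _ [Es _ Eb1 _ _] std] cgt a1s b1s sa1 b8; rewrite leqNgt;
    apply/negP => gt8.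
have := std (a1 + s) ltac:(lia).
rewrite (diffs_eq0_hi _ _ _ Eb1); last by lia.
rewrite (diffs_eq0_lo _ _ _ Es); last by lia.
have -> : (a1 + s == 9) = false by clear -a1s; lia.
have -> : ((a1 + s).+1 == s.+1) = false by clear -sa1; lia.
have -> : (a1 + s + b1 == 10) = false by clear -gt8 sa1 sb1 a1s b8; lia.
by clear -cgt; lia.
Qed.

(** Excludes smallest digit 0: the number of digits 3 would grow by one at each step around the
    cycle. *)
Lemma no_nine0 n c d :
  counts_step n c d 0 8 1 -> counts_step n d c 0 8 1 ->
  c 0 = 1 -> c 9 = 0 -> d 3 = c 3 + 1.
Proof.
move=> [_ _ _ [h5 h6 h7 h8 h9] stc] [_ _ _ [k5 k6 k7 k8 k9] std] c0 c9.
have c8 : c 8 = (c 1).+2.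
  by move: (std 1 isT) (std 8 isT); rewrite !subSS !subn0 /=; clear; lia.
have [p2 c7] : 0 < c 2 /\ c 2 = (c 7).+1.
  by move: (std 2 isT) (std 7 isT); rewrite !subSS !subn0 /=; clear; lia.
have c6 : c 6 = c 3.
  by move: (std 3 isT) (std 6 isT); rewrite !subSS !subn0 /=; clear; lia.
have c5 : c 5 = c 4.
  by move: (std 4 isT) (std 5 isT); rewrite !subSS !subn0 /=; clear; lia.
clear -c0 c9 c8 p2 c7 c6 c5 stc.
have e3 : diffs_ge c 3 = c 1 + c 7 + c 3 + 2 by diffs_ge_max2 3 3.
have e4 : diffs_ge c 4 = c 1 + c 7 + 2 by diffs_ge_max2 2 3.
have e6 : diffs_ge c 6 = c 1 + 2 by diffs_ge_max2 2 2.
have e7 : diffs_ge c 7 = c 1 + 1 by diffs_ge_max2 1 1.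
by have := stc 3 isT; rewrite !subSS !subn0 /diffs_eq /= e3 e4 e6 e7; clear; lia.
Qed.

(** [c 5 = 0] because half of [n] is the number of differences of at least 2, hence at most
    [c 2 + c 3 + 2]. Used in both directions, the conclusion gives [c 2 = d 2 = 0], and then the two
    counts agree. *)
Lemma no_nine1 n c d :
  counts_step n c d 1 6 2 -> counts_step n d c 1 6 2 ->
  c 0 = 0 -> c 1 = 1 -> c 9 = 0 -> n = (diffs_ge c 1).*2 -> count_ge c 0 = n ->
  [/\ c 7 = (c 2).+1, c 6 = (c 3).+1, c 4 = (c 5).+1, c 8 = 0 & c 5 = 0 /\ c 2 <= d 5].
Proof.
move=> [_ _ _ [h5 h6 h7 h8 h9] stc] [_ _ _ [k5 k6 k7 k8 k9] std] c0 c1 c9 nE cn.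
have c7 : c 7 = (c 2).+1.
  by move: (std 2 isT) (std 7 isT); rewrite !subSS !subn0 /=; clear; lia.
have c6 : c 6 = (c 3).+1.
  by move: (std 3 isT) (std 6 isT); rewrite !subSS !subn0 /=; clear; lia.
have c4 : c 4 = (c 5).+1.
  by move: (std 4 isT) (std 5 isT); rewrite !subSS !subn0 /=; clear; lia.
have c8 : c 8 = 0.
  move: (std 8 isT); rewrite !subSS !subn0 /= (diffs_eq0_lo _ _ 1 k5) // (diffs_eq0_hi _ _
      8 k7) //; lia.
have e2 : diffs_ge c 2 <= c 2 + c 3 + 2.
  clear -c0 c1 c9 c8 c7 c6 c4; bound_overlaps; rewrite ?c0 ?c1 ?c9 ?c8 ?c7 ?c6 ?c4; lia.
have e5 : diffs_ge c 5 = (c 2).+1.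
  clear -c0 c1 c9 c8 c7 c6 c4. diffs_ge_max2 2 2.
have e6 : diffs_ge c 6 = 1.
  clear -c0 c1 c9 c8 c7 c6 c4. diffs_ge_max2 1 1.
split=> //; split.
  move: e2 cn; rewrite h5 nE /count_ge /= c0 c1 c9 c8 c7 c6 c4; clear; lia.
by have := stc 5 isT; rewrite !subSS !subn0 /diffs_eq e5 e6 /=; clear; lia.
Qed.

(** At most [c 3 + 1] differences are 3 or more, but without leftover digits there must be [n / 2]
    of them, which is larger. *)
Lemma no_nine2 n c d :
  counts_step n c d 2 4 3 -> counts_step n d c 2 4 3 ->
  c 0 = 0 -> c 1 = 0 -> c 2 = 1 -> c 9 = 0 -> n = (diffs_ge c 1).*2 -> count_ge c 0 = n ->
      False.
Proof.
move=> [_ _ cgt [h5 h6 h7 h8 h9] stc] [_ _ _ [k5 k6 k7 k8 k9] std] c0 c1 c2 c9 nE cn.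
have c7 := cgt 7 isT; have c8 := cgt 8 isT.
have c6 : c 6 = (c 3).+2.
  by move: (std 3 isT) (std 6 isT); rewrite !subSS !subn0 /=; clear; lia.
have c4 : c 4 = (c 5).+1.
  by move: (std 4 isT) (std 5 isT); rewrite !subSS !subn0 /=; clear; lia.
have e3 : diffs_ge c 3 <= c 3 + 1.
  clear -c0 c1 c2 c9 c8 c7 c6 c4; bound_overlaps; rewrite ?c0 ?c1 ?c2 ?c9 ?c8 ?c7 ?c6 ?c4; lia.
by move: e3 cn; rewrite h5 nE /count_ge /= c0 c1 c2 c9 c8 c7 c6 c4; clear; lia.
Qed.

(** * Conclusion *)

Lemma mirrored_image n c c' j : mirrored n c c' -> j < 9 -> c' j = diffs_eq c j + diffs_eq
    c (9 - j).
Proof. by move=> mir j9; rewrite (mir j (ltnW j9)) (ltn_eqF j9) mul0n addn0. Qed.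

(** The number of leftover digits does not increase in either direction, so it is the same [z] for
    both numbers. *)
Lemma mirrored_palindromic n c c' : mirrored n c c' -> mirrored n c' c ->
    (diffs_ge c 1).*2 <= n -> (diffs_ge c' 1).*2 <= n ->
  [/\ palindromic c (n - (diffs_ge c 1).*2), palindromic c' (n - (diffs_ge c 1).*2),
   count_le c 4 = count_le c' 4, diffs_ge c 1 = count_le c 4 & diffs_ge c' 1 = count_le c'
       4].
Proof.
move=> mir mir' Ec Ec'.
have [b8 b7 b6 b5 [b9 bn le]] := mirroredP _ _ _ mir Ec.
have [a8 a7 a6 a5 [a9 an le']] := mirroredP _ _ _ mir' Ec'.
have e : n - (diffs_ge c 1).*2 = n - (diffs_ge c' 1).*2 by apply/eqP;
    rewrite eqn_leq le' le.
have h (b : nat -> nat) : b 8 = b 1 -> b 7 = b 2 -> b 6 = b 3 -> b 5 = b 4 -> b 9 = b 0 +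
    (n - (diffs_ge c 1).*2) ->
   count_ge b 0 = n -> diffs_ge c 1 = count_le b 4.
  by rewrite /count_ge /count_le /=; clear -Ec; lia.
rewrite -e in a9; have hc := h c a8 a7 a6 a5 a9 an; have hc' := h c' b8 b7 b6 b5 b9 bn.
split=> //; first by rewrite -hc.
by rewrite -hc'; clear -e Ec Ec'; lia.
Qed.

Lemma two_cycle_counts n c d s a1 ar b1 br :
  counts_step n c d s a1 ar -> counts_step n d c s b1 br ->
  (forall j, j < s -> c j = 0) -> (forall j, j < s -> d j = 0) ->
  0 < c s -> 0 < d s -> count_ge c 0 = n -> count_ge d 0 = n ->
  (exists2 j, j < 10 & c j <> d j) ->
  exists u v z, [/\ u + v < z, 0 < u + v, u != v,
    [seq c j | j <- rev (iota 0 10)] =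
      [:: z; z - v - u; z + v; z - v; z; z; z - v; z + v; z - v - u; 0] &
    [seq d j | j <- rev (iota 0 10)] =
      [:: z; z - v - u; z + u; z - u; z; z; z - u; z + u; z - v - u; 0]].
Proof.
move=> sc sd c0 d0 cs ds cn dn [j0 j010 ne].
have neq : [/\ c 0 = d 0, c 1 = d 1, c 2 = d 2, c 3 = d 3 & c 4 = d 4] ->
    [/\ c 5 = d 5, c 6 = d 6, c 7 = d 7, c 8 = d 8 & c 9 = d 9] -> False.
  move=> [? ? ? ? ?] [? ? ? ? ?]; case: ne.
  by move: j0 j010; do 10![case=> //].
clear ne j010 j0.
move: (sc) (sd) => [/andP[sar ara1] [a1s ca1] _ [Ear EarS _ _ Enc] _]
  [/andP[_ brb1] [b1s db1] _ [Ebr EbrS _ _ End] _].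
case: (two_cycle_cases _ _ _ _ _ _ _ _ sc sd c0 d0 cs ds); last first.
  move=> [ae be c9 d9 [cs1 ds1 nc nd]]; exfalso.
  have [_ _ a9 _ _] := no_nine _ _ _ _ _ _ _ _ sc sd c0 d0 cs ds c9.
  have [_ _ b9 _ _] := no_nine _ _ _ _ _ _ _ _ sd sc d0 c0 ds cs d9.
  rewrite ae in sc sar ara1; rewrite be in sd brb1.
  (* Both largest differences equal [8 - 2 s]; being at least [s + 1], they leave only
     [s = 0, 1, 2]. *)
  have a8 : a1 + s.*2 = 8.
    apply/eqP; rewrite eqn_leq (top_diff_ge _ _ _ _ _ _ sd) //; last by case: sc.
    rewrite (top_diff_le _ _ _ _ _ _ sd) //.
    by apply: (top_diff_ge _ _ _ _ _ _ sc) => //; case: sd.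
  have b8 : b1 + s.*2 = 8.
    apply/eqP; rewrite eqn_leq (top_diff_ge _ _ _ _ _ _ sc) //; last by case: sd.
    by rewrite (top_diff_le _ _ _ _ _ _ sc) // a8.
  have {a8 b8} [ea eb] : a1 = 8 - s.*2 /\ b1 = 8 - s.*2 by clear -a8 b8; lia.
  have s3 : s < 3 by clear -ea ara1; lia.
  subst a1 b1; destruct s as [|[|[|s]]]; last by [].
  - have := no_nine0 _ _ _ sc sd cs1 c9; have := no_nine0 _ _ _ sd sc ds1 d9; clear; lia.
  - have [c7 c6 c4 c8 [c5 cd]] := no_nine1 _ _ _ sc sd (c0 0 isT) cs1 c9 nc cn.
    have [d7 d6 d4 d8 [d5 dc]] := no_nine1 _ _ _ sd sc (d0 0 isT) ds1 d9 nd dn.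
    move: (c0 0 isT) (d0 0 isT) => {}c0 {}d0.
    rewrite d5 in cd; rewrite c5 in dc.
    have e3 : c 3 = d 3.
      move: dn; rewrite -cn /count_ge /= c0 d0 cs1 ds1 c7 c6 c4 c8 c5 c9 d7 d6 d4 d8 d5 d9;
          clear -cd dc; lia.
    by apply: neq; split; rewrite ?c0 ?d0 ?cs1 ?ds1 ?c7 ?c6 ?c4 ?c8 ?c5 ?c9 ?d7 ?d6 ?d4 ?d8
        ?d5 ?d9 ?e3 //; clear -cd dc; lia.
  - exact: (no_nine2 _ _ _ sc sd (c0 0 isT) (c0 1 isT) cs1 c9 nc cn).
move=> [ae be mcd mdc [cds cz dz]].
have [palc pald eh Ec1 Ed1] := mirrored_palindromic _ _ _ mcd mdc Enc End.
set z := n - _ in palc pald.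
have ic j (j9 : j < 9) := mirrored_image _ _ _ j mcd j9.
have id j (j9 : j < 9) := mirrored_image _ _ _ j mdc j9.
move: (palc) (pald) => [c5 c6 c7 c8 c9] [d5 d6 d7 d8 d9].
have {}neq : c 0 = d 0 -> c 1 = d 1 -> c 2 = d 2 -> c 3 = d 3 -> c 4 = d 4 -> False.
  by move=> h0 h1 h2 h3 h4; apply: neq => //;
      rewrite c5 c6 c7 c8 c9 d5 d6 d7 d8 d9 h0 h1 h2 h3 h4.
rewrite {}ae in sar ara1 Ear EarS; rewrite {}be in brb1 Ebr EbrS.
have s4 : s < 5 by clear -ara1 a1s; lia.
move: eh (eh); rewrite {1}/count_le {1}/count_le /= => eh' eh.
destruct s as [|[|[|[|[|s]]]]]; last by [].
all: clear sar ara1 a1s ca1 sc sd brb1 b1s db1.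
- exfalso; have [h1 h2 h3 h4] := palindromic0_cycle _ _ _ palc pald cds eh Ec1 EarS Ed1 EbrS
    (ic 1 isT) (ic 2 isT) (ic 4 isT) (id 1 isT) (id 2 isT) (id 4 isT); exact: neq.
- have c00 := c0 0 isT; have d00 := d0 0 isT.
  have cz' : c 1 <= z by rewrite c9 c00 in cz.
  have dz' : d 1 <= z by rewrite d9 d00 in dz.
  have ne2 : c 2 <> d 2.
    have [c4 _ _ _ _] := diffs_palindromic1 _ _ palc c00 cz' cs Ec1 Ear EarS.
    have [d4 _ _ _ _] := diffs_palindromic1 _ _ pald d00 dz' ds Ed1 Ebr EbrS.
    move=> e2; apply: neq; rewrite ?c00 ?d00 ?c4 ?d4 //.
    by move: eh'; rewrite c00 d00 c4 d4 cds e2; clear; lia.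
  have [c4 d4 c23 d23 [zc zd w]] := palindromic1_cycle _ _ _ palc pald c00 d00 cds cz' cs eh
    Ec1 Ear EarS Ed1 Ebr EbrS (ic 4 isT) (ic 2 isT) (id 4 isT) (id 2 isT) ne2.
  (* Since [c 2 = z + v] and [d 2 = z + u], the relation [c 1 + c 2 + d 2 = 3 * z] makes [c 1] equal
     to [z - v - u]; it is positive, whence [u + v < z]. *)
  exists (d 2 - z), (c 2 - z), z; rewrite /= c5 c6 c7 c8 c9 d5 d6 d7 d8 d9 c00 d00 c4 d4
      -cds.
  move: cs; clear -c23 d23 zc zd w ne2 => cs.
  split; [lia|lia|lia| |].
  + by do 9?congr cons => //; lia.
  + by do 9?congr cons => //; lia.
- exfalso.
  have c00 := c0 0 isT; have d00 := d0 0 isT; have c1 := c0 1 isT; have d1 := d0 1 isT.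
  have cz' : 0 < c 2 <= z by rewrite cs; rewrite c9 c00 in cz.
  have [h3 h4] := palindromic2_cycle _ _ _ palc pald c00 d00 c1 d1 cds cz' eh Ec1 Ear EarS
      Ed1 Ebr EbrS
    (ic 4 isT) (id 4 isT).
  by apply: neq; rewrite // ?c00 ?d00 ?c1 ?d1.
(* For [s = 3] the count of digits up to 4 fixes [c 4]; for [s = 4] it is the count of the smallest
   digit itself. *)
- exfalso; move: (c0 0 isT) (c0 1 isT) (c0 2 isT) (d0 0 isT) (d0 1 isT) (d0 2 isT) => h0 h1
    h2 k0 k1 k2.
  apply: neq; rewrite ?h0 ?h1 ?h2 ?k0 ?k1 ?k2 //.
  by move: eh'; rewrite h0 h1 h2 k0 k1 k2 cds; clear; lia.
- exfalso; move: (c0 0 isT) (c0 1 isT) (c0 2 isT) (c0 3 isT) (d0 0 isT) (d0 1 isT) (d0 2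
    isT) (d0 3 isT) => h0 h1 h2 h3 k0 k1 k2 k3.
  by apply: neq; rewrite ?h0 ?h1 ?h2 ?h3 ?k0 ?k1 ?k2 ?k3.
Qed.

(** * From digit counts back to numbers *)

Lemma kaprekar0 n : kaprekar n 0 = 0.
Proof.
have of_digits0 s : all (pred1 0) s -> of_digits s = 0.
  elim/last_ind: s => // s d IH; rewrite all_rcons => /andP[/eqP-> /IH].
  by rewrite of_digits_rcons => ->.
rewrite /kaprekar /descending of_digits0 // all_sort all_rev.
by apply/allP => d /mapP[i _ ->]; rewrite /= div0n mod0n.
Qed.

Lemma min_digitP n N : 0 < n ->
  min_digit n N \in digits n N /\ all (leq (min_digit n N)) (digits n N).
Proof.
have min_seq s : s != [::] -> all (gtn 10) s ->
    \big[minn/9]_(d <- s) d \in s /\ all (leq (\big[minn/9]_(d <- s) d)) s.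
  elim: s => // d s IH _ /= /andP[d10 s10]; rewrite big_cons.
  have [->|s0] := eqVneq s [::].
    by rewrite big_nil (minn_idPl _) // inE eqxx /= leqnn.
  have [ms lem] := IH s0 s10; rewrite geq_minl inE /=.
  set m := \big[_/_]_(_ <- _) _ in ms lem *; split.
    by case: (leqP d m) => _; rewrite ?eqxx // ms orbT.
  by apply: sub_all lem => e; apply: leq_trans; apply: geq_minr.
move=> n0; apply: min_seq (digits_lt10 _ _).
by rewrite -size_eq0 size_digits -lt0n.
Qed.

Lemma tally_seq_sorted l : sorted geq (unzip1 l) -> sorted geq (tally_seq l).
Proof.
have geqT : transitive geq by move=> x y z /=; lia.
rewrite !sorted_pairwise //; elim: l => //= -[d m] l IH /andP[dl /IH pl].
rewrite pairwise_cat pl andbT; apply/andP; split.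
  apply/allrelP => x y /nseqP[-> _] /flatten_mapP[[e k] el /nseqP[-> _]].
  by apply: (allP dl); apply/mapP; exists (e, k).
by apply/(pairwiseP 0) => i j; rewrite !inE size_nseq => im jm _;
    rewrite !nth_nseq im jm /=.
Qed.

Lemma count_tally_seq j (l : seq (nat * nat)) :
  count_mem j (tally_seq l) = sumn [seq (xm.1 == j) * xm.2 | xm <- l].
Proof. by elim: l => //= -[d m] l IH; rewrite count_cat count_nseq IH. Qed.

Lemma descending_runs n N l : sorted geq (unzip1 l) -> all (gtn 10) (unzip1 l) ->
  (forall j, j < 10 -> count_mem j (digits n N) = count_mem j (tally_seq l)) ->
  descending n N = runs l.
Proof.
move=> ls l10 cnt; congr of_digits.
have geqT : transitive geq by move=> x y z /=; lia.
apply: (@sorted_eq _ geq) => //; first by move=> x y /=; lia.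
- by apply: sort_sorted => x y /=; lia.
- exact: tally_seq_sorted.
rewrite perm_sort; apply/allP => j _ /=; apply/eqP.
case: (ltnP j 10) => j10; first exact: cnt.
have jd : j \notin digits n N.
  by apply/negP => /(allP (digits_lt10 n N)) /=; rewrite ltnNge j10.
have jl : j \notin tally_seq l.
  apply/negP => /flatten_mapP[[e k] el /nseqP[je _]].
  have /(allP l10) /= : e \in unzip1 l by apply/mapP; exists (e, k).
  by rewrite -[e]/(e, k).1 -je ltnNge j10.
by rewrite !(count_memPn _).
Qed.

Lemma kaprekar_step_at n C D s : kaprekar n C = D -> 0 < D ->
    s \in digits n C -> all (leq s) (digits n C) -> all (leq s) (digits n D) ->
  let c N j := count_mem j (digits n N) in
  exists d1 dr, counts_step n (c C) (c D) s d1 dr.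
Proof.
move=> kC D0 sC minC minD c.
have c0 N : all (leq s) (digits n N) -> forall j, j < s -> c N j = 0.
  by move=> /allP minN j js; apply/count_memPn; apply/negP => /minN; rewrite leqNgt js.
have := kaprekar_step n C; rewrite kC => /(_ D0) st.
apply: (step_min _ _ _ _ st); [|exact: c0|exact: c0|].
- by have := allP (digits_lt10 n C) _ sC.
by rewrite -has_count has_pred1.
Qed.

Theorem theorem1p5 (n C D : nat) :
  kaprekar_2cycle n C D ->
  min_digit n C = min_digit n D ->
  exists u v z : nat,
    [/\ u + v < z, 0 < u + v, u != v &
        [:: descending n C; descending n D] =i
        [:: runs [:: (9, z); (8, z - v - u); (7, z + v); (6, z - v); (5, z);
                     (4, z); (3, z - v); (2, z + v); (1, z - v - u)];
            runs [:: (9, z); (8, z - v - u); (7, z + u); (6, z - u); (5, z);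
                     (4, z); (3, z - u); (2, z + u); (1, z - v - u)]]].
Proof.
move=> [Cn Dn neCD kC kD] minCD.
have n0 : 0 < n by case: n Cn Dn {kC kD minCD} => //; case: C D neCD => [|C] [|D].
have D0 : 0 < D.
  by rewrite lt0n; apply: contraNneq neCD => D0; rewrite -kD D0 kaprekar0.
have C0 : 0 < C.
  by rewrite lt0n; apply: contraNneq neCD => C0; rewrite -kC C0 kaprekar0.
have [sC lC] := min_digitP _ C n0; have [sD lD] := min_digitP _ D n0.
rewrite -minCD in sD lD; move: (min_digit n C) sC lC sD lD => s sC lC sD lD.
pose c N j := count_mem j (digits n N).
have c0 N : all (leq s) (digits n N) -> forall j, j < s -> c N j = 0.
  by move=> /allP minN j js; apply/count_memPn; apply/negP => /minN; rewrite leqNgt js.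
have cs N : s \in digits n N -> 0 < c N s by rewrite -has_count has_pred1.
have cn N : count_ge (c N) 0 = n.
  by rewrite -count_ge_digits ?digits_lt10 // -[RHS](size_digits n N); apply/eqP;
      rewrite -all_count; apply/allP.
have [a1 [ar sc]] := kaprekar_step_at _ _ _ _ kC D0 sC lC lD.
have [b1 [br sd]] := kaprekar_step_at _ _ _ _ kD C0 sD lD lC.
(* k depends only on the digit counts, so equal counts would give [C = D]. *)
have ne : exists2 j, j < 10 & c C j <> c D j.
  case: (boolP [exists j : 'I_10, c C j != c D j]) => [/existsP[j /eqP ne]|];
      first by exists j.
  rewrite negb_exists => /forallP eq; case/eqP: neCD.
  have pCD : perm_eq (digits n C) (digits n D).
    apply/allP => j; rewrite mem_cat => jCD /=.
    have j10 : j < 10 by case/orP: jCD => /(allP (digits_lt10 _ _)).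
    by have := eq (Ordinal j10); rewrite negbK.
  have geqT : total geq by move=> x y; exact: leq_total.
  have geqA : antisymmetric geq by move=> x y; rewrite andbC; exact: anti_leq.
  have geqTr : transitive geq by move=> x y z /[swap]; exact: leq_trans.
  rewrite -[RHS]kC -[LHS]kD /kaprekar /descending /ascending.
  rewrite (perm_sortP geqT geqTr geqA _ _ pCD).
  by rewrite (perm_sortP leq_total leq_trans anti_leq _ _ pCD).
have [u [v [z [uvz uv0 uv eC eD]]]] := two_cycle_counts _ _ _ _ _ _ _ _ sc sd
  (c0 _ lC) (c0 _ lD) (cs _ sC) (cs _ sD) (cn C) (cn D) ne.
exists u, v, z; split=> // t.
rewrite !(descending_runs n C [:: (9, z); (8, z - v - u); (7, z + v); (6, z - v); (5, z);
                     (4, z); (3, z - v); (2, z + v); (1, z - v - u)]) //.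
rewrite !(descending_runs n D [:: (9, z); (8, z - v - u); (7, z + u); (6, z - u); (5, z);
                     (4, z); (3, z - u); (2, z + u); (1, z - v - u)]) //.
- move: eD; rewrite /c /= => -[e9 e8 e7 e6 e5 e4 e3 e2 e1 e0].
  by do 10?[case=> [_|]] => //; rewrite count_tally_seq /= ?(e9, e8, e7, e6, e5, e4, e3,
      e2, e1, e0); lia.
move: eC; rewrite /c /= => -[e9 e8 e7 e6 e5 e4 e3 e2 e1 e0].
by do 10?[case=> [_|]] => //; rewrite count_tally_seq /= ?(e9, e8, e7, e6, e5, e4, e3, e2,
    e1, e0); lia.
Qed.
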